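(* Let $\mathbb{T}\subseteq\mathbb{R}$ be an interval, let $\tau\colon\mathbb{T}\to\mathbb{T}'$ be a twice continuously differentiable increasing function with $\dot\tau(t)>0$ for all $t\in\mathbb{T}$, where $\mathbb{T}'=\tau(\mathbb{T})$, and let $\alpha,\beta,\gamma\colon\mathbb{T}'\to\mathbb{R}$ be continuously differentiable. Suppose that the curve $X\colon\mathbb{T}'\to\mathbb{R}^d$ satisfies the Euler-Lagrange equation of the Bregman Lagrangian $\mathcal{L}_{\alpha,\beta,\gamma}$ on $\mathbb{T}'$. Then the reparameterized curve $Y\colon\mathbb{T}\to\mathbb{R}^d$, $Y_t=X_{\tau(t)}$, satisfies the Euler-Lagrange equation of the Bregman Lagrangian $\mathcal{L}_{\tilde\alpha,\tilde\beta,\tilde\gamma}$ on $\mathbb{T}$, where $$\tilde\alpha_t=\alpha_{\tau(t)}+\log\dot\tau(t),\qquad \tilde\beta_t=\beta_{\tau(t)},\qquad \tilde\gamma_t=\gamma_{\tau(t)}\qquad(t\in\mathbb{T}).$$ Furthermore, $\alpha,\beta,\gamma$ satisfy the ideal scaling conditions on $\mathbb{T}'$ if and only if $\tilde\alpha,\tilde\beta,\tilde\gamma$ satisfy the ideal scaling conditions on $\mathbb{T}$.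
   Context: Here $f\colon\mathbb{R}^d\to\mathbb{R}$ is a continuously differentiable convex function, and $h\colon\mathbb{R}^d\to\mathbb{R}$ is convex, twice continuously differentiable with invertible Hessian $\nabla^2h$, and essentially smooth ($\|\nabla h(x)\|\to\infty$ as $\|x\|\to\infty$). The Bregman divergence of $h$ is $D_h(y,x)=h(y)-h(x)-\langle\nabla h(x),y-x\rangle$. For continuously differentiable functions $\alpha,\beta,\gamma$ on an interval, the Bregman Lagrangian is $$\mathcal{L}_{\alpha,\beta,\gamma}(X,V,t)=e^{\alpha_t+\gamma_t}\big(D_h(X+e^{-\alpha_t}V,X)-e^{\beta_t}f(X)\big),$$ and its Euler-Lagrange equation, for a twice differentiable curve $X_t$, is $$\ddot X_t+(e^{\alpha_t}-\dot\alpha_t)\dot X_t+e^{2\alpha_t+\beta_t}\big[\nabla^2h(X_t+e^{-\alpha_t}\dot X_t)\big]^{-1}\nabla f(X_t)+e^{\alpha_t}(\dot\gamma_t-e^{\alpha_t})\big[\nabla^2h(X_t+e^{-\alpha_t}\dot X_t)\big]^{-1}\big(\nabla h(X_t+e^{-\alpha_t}\dot X_t)-\nabla h(X_t)\big)=0.$$ The ideal scaling conditions for $\alpha,\beta,\gamma$ are: $\dot\beta_t\le e^{\alpha_t}$ and $\dot\gamma_t=e^{\alpha_t}$ for all $t$ in the interval. A dot denotes the derivative with respect to the time argument. *)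

(* Defs.v *)
From HB Require Import structures.
From mathcomp Require Export all_boot all_order all_algebra.
From mathcomp Require Export all_classical all_reals all_analysis.

Set Implicit Arguments.
Unset Strict Implicit.
Unset Printing Implicit Defensive.

Import Order.TTheory GRing.Theory Num.Theory.
Export numFieldNormedType.Exports.

Local Open Scope classical_set_scope.
Local Open Scope ring_scope.

(* Derivatives relative to a set [T] of times: the increment stays in [T], so
   that they are one-sided at an endpoint of an interval belonging to it, and
   only the values of the function on [T] matter.  [deriv_in] is meaningful only
   at a point of [T] that is not isolated in [T]. *)
Section DerivativesOnASet.
Context {R : realType} {V : normedModType R}.
Implicit Types (T : set R) (f : R -> V) (t : R).

Definition diff_quot f t : R -> V := fun s => (s - t)^-1 *: (f s - f t).

Definition derivable_in T f t : Prop :=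
  cvg (diff_quot f t s @[s --> within T t^']).

Definition deriv_in T f t : V :=
  lim (diff_quot f t s @[s --> within T t^']).

Definition derivable_on T f : Prop := forall t, T t -> derivable_in T f t.

Definition C1_on T f : Prop :=
  derivable_on T f /\ {within T, continuous (deriv_in T f)}.

Definition C2_on T f : Prop := derivable_on T f /\ C1_on T (deriv_in T f).

End DerivativesOnASet.

Section MultivariateCalculus.
Context {R : realType} {d : nat}.
Implicit Types (f : 'cV[R]_d -> R) (x : 'cV[R]_d).

(* The library norm of ['cV_d] is the sup norm. *)
Definition enorm x : R := Num.sqrt (\sum_i x i 0 ^+ 2).

Definition gradient f x : 'cV[R]_d := \col_i 'D_(delta_mx i 0) f x.

Definition hessian f x : 'M[R]_d :=
  \matrix_(i, j) 'D_(delta_mx i 0) (fun y => 'D_(delta_mx j 0) f y) x.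

Definition C1 f : Prop :=
  (forall x, differentiable f x) /\ continuous (gradient f).

Definition C2 f : Prop :=
  [/\ C1 f, forall x, differentiable (gradient f) x & continuous (hessian f)].

Definition ess_smooth f : Prop :=
  forall M : R, exists K : R, forall x, K <= enorm x -> M <= enorm (gradient f x).

End MultivariateCalculus.

Section BregmanLagrangian.
Context {R : realType} {d : nat}.
Implicit Types (T : set R) (f h : 'cV[R]_d -> R) (alpha beta gamma : R -> R).

(* [X] is twice differentiable on [T] and solves the Euler-Lagrange equation
     d/dt (dL/dV (X t, X' t, t)) = dL/dX (X t, X' t, t)
   of the Bregman Lagrangian
     L(X, V, t) = e^(alpha t + gamma t)
                    (D_h(X + e^(- alpha t) V, X) - e^(beta t) f(X)),
     D_h(y, x) = h(y) - h(x) - <grad h(x), y - x>,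
   in its expanded form, solved for the second derivative of [X]. *)
Definition bregman_EL T f h alpha beta gamma (X : R -> 'cV[R]_d) : Prop :=
  let X' := deriv_in T X in
  let X'' := deriv_in T X' in
  [/\ derivable_on T X, derivable_on T X'
    & forall t, T t ->
      let Z := X t + expR (- alpha t) *: X' t in
      let Hinv := invmx (hessian h Z) in
      X'' t
      + (expR (alpha t) - deriv_in T alpha t) *: X' t
      + expR (2 * alpha t + beta t) *: (Hinv *m gradient f (X t))
      + (expR (alpha t) * (deriv_in T gamma t - expR (alpha t))) *:
          (Hinv *m (gradient h Z - gradient h (X t)))
      = 0].

Definition ideal_scaling T alpha beta gamma : Prop :=
  forall t, T t ->
    deriv_in T beta t <= expR (alpha t) /\ deriv_in T gamma t = expR (alpha t).

End BregmanLagrangian.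

(* Main.v *)
(* The exponential of the new alpha at t is e^alpha at tau t times the derivative
   tau' of tau at t, so the point at which the Hessian of h is evaluated does not
   move, and the Euler-Lagrange expression of the reparameterized curve at t is
   tau'^2 times that of X at tau t: the term in tau'' produced by the chain rule is
   cancelled by the derivative of log tau'.  Both ideal scaling conditions are
   multiplied by tau' > 0. *)
Require Import Defs.
From mathcomp Require Import ring lra.

Import Order.TTheory GRing.Theory Num.Theory.

Local Open Scope classical_set_scope.
Local Open Scope ring_scope.

(** [deriv_in] is a [lim], hence a default value when no limit exists. The relation carries
    existence and value together, so the calculus rules can be stated for it directly. *)
Definition is_deriv_in {R : realType} {V : normedModType R}
    (T : set R) (f : R -> V) (t : R) (l : V) : Prop :=
  diff_quot f t s @[s --> within T t^'] --> l.

(** * Calculus of derivatives relative to a set of times *)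

Section DerivIn.
Set Implicit Arguments.
Unset Strict Implicit.

Context {R : realType}.
Implicit Types (V : normedModType R) (T : set R) (t : R).

(** No point of a nondegenerate interval is isolated in it: from [t] one can move towards [b] if
    [t < b], and towards [a] otherwise. Uniqueness of limits, and so the value of [deriv_in], rests
    on this. *)
Lemma within_dnbhs_proper T t : is_interval T ->
  (exists a b, [/\ T a, T b & a < b]) -> T t ->
  ProperFilter (within T t^').
Proof.
move=> Titv [a [b [Ta Tb ab]]] Tt; apply: Build_ProperFilter_ex => A /=.
rewrite /within /= => /nbhs_ballP[e /= e0 He].
suff [s [Ts sNt bs]] : exists s, [/\ T s, s != t & `|t - s| < e].
  by exists s; apply: He.
have [tb|bt] := ltP t b.
  (* The cap [b - t] keeps [s] in [T], and [e / 2] keeps it strictly inside the ball. *)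
  pose s := t + Num.min (b - t) (e / 2).
  have m0 : 0 < Num.min (b - t) (e / 2) by rewrite lt_min subr_gt0 tb divr_gt0.
  have mb : Num.min (b - t) (e / 2) <= b - t by rewrite ge_min lexx.
  have me : Num.min (b - t) (e / 2) <= e / 2 by rewrite ge_min lexx orbT.
  exists s; rewrite /s; split.
  - by apply: (Titv t b) => //; apply/andP; split; lra.
  - by rewrite gt_eqF //; lra.
  - by rewrite ltr_norml; apply/andP; split; lra.
have at' : a < t by apply: lt_le_trans bt.
pose m := Num.min (t - a) (e / 2).
have m0 : 0 < m by rewrite lt_min subr_gt0 at' divr_gt0.
have mb : m <= t - a by rewrite ge_min lexx.
have me : m <= e / 2 by rewrite ge_min lexx orbT.
exists (t - m); split.
- by apply: (Titv a t) => //; apply/andP; split; lra.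
- by rewrite lt_eqF //; lra.
- by rewrite ltr_norml; apply/andP; split; lra.
Qed.

Lemma derivable_in_is_deriv V T (f : R -> V) t :
  derivable_in T f t -> is_deriv_in T f t (deriv_in T f t).
Proof. by []. Qed.

Lemma is_deriv_in_deriv V T (f : R -> V) t l :
  ProperFilter (within T t^') -> is_deriv_in T f t l ->
  derivable_in T f t /\ deriv_in T f t = l.
Proof.
move=> PF H; split; first by apply/cvg_ex; exists l.
exact: cvg_lim.
Qed.

(* Caratheodory's form of the derivative, which avoids dividing by
   increments that may vanish in the chain rule. *)
Lemma is_deriv_inP V T (f : R -> V) t l :
  is_deriv_in T f t l <->
  exists phi : R -> V, [/\ phi s @[s --> within T (nbhs t)] --> l, phi t = l &
    forall s, T s -> f s = f t + (s - t) *: phi s].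
Proof.
split=> [H|[phi [phil phit fE]]].
  exists (fun s => if s == t then l else diff_quot f t s); split.
  - move=> U Ul.
    have Hf : \forall s \near t, s != t -> T s -> U (diff_quot f t s) := H U Ul.
    change (\forall s \near t, T s -> U (if s == t then l else diff_quot f t s)).
    apply: filterS Hf => s Hs Ts; case: eqVneq => [_|sNt].
      exact: (nbhs_singleton Ul).
    exact: Hs.
  - by rewrite eqxx.
  - move=> s _; case: eqVneq => [->|sNt]; first by rewrite subrr scale0r addr0.
    by rewrite /diff_quot scalerA divff ?subr_eq0// scale1r addrC subrK.
move=> U Ul; have H : \forall s \near t, T s -> U (phi s) := phil U Ul.
change (\forall s \near t, s != t -> T s -> U (diff_quot f t s)).
apply: filterS H => s Hs sNt Ts.
rewrite /diff_quot fE// addrAC subrr add0r scalerA mulVf ?subr_eq0// scale1r.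
exact: Hs.
Qed.

Lemma is_deriv_in_continuous V T (f : R -> V) t l : is_deriv_in T f t l ->
  f s @[s --> within T (nbhs t)] --> f t.
Proof.
move=> /is_deriv_inP[phi [phil phit fE]].
have : (f t + (s - t) *: phi s) @[s --> within T (nbhs t)] -->
    f t + (t - t) *: l.
  apply: cvgD; first exact: cvg_cst.
  apply: cvgZ => //; apply: cvgB; last exact: cvg_cst.
  exact: cvg_within.
rewrite subrr scale0r addr0; apply: cvg_trans.
apply: near_eq_cvg; apply: (filterE (F := nbhs t)) => s Ts /=.
by rewrite -fE.
Qed.

(* [subspace_continuousP] with the coercion [from_subspace] unfolded. *)
Lemma within_continuousP V T (f : R -> V) : {within T, continuous f} <->
  forall t, T t -> f s @[s --> within T (nbhs t)] --> f t.
Proof. exact: subspace_continuousP. Qed.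

Lemma derivable_on_continuous V T (f : R -> V) :
  derivable_on T f -> {within T, continuous f}.
Proof.
move=> fT; apply/within_continuousP => t /fT/derivable_in_is_deriv.
exact: is_deriv_in_continuous.
Qed.

(** The neighbourhoods are full rather than punctured, so [g] may return to the value [g t] near
    [t]. *)
Lemma within_cvg_comp {U : topologicalType} T T' (g : R -> R) (f : R -> U) t (l : U) :
  (forall s, T s -> T' (g s)) -> g s @[s --> within T (nbhs t)] --> g t ->
  f s @[s --> within T' (nbhs (g t))] --> l ->
  f (g s) @[s --> within T (nbhs t)] --> l.
Proof.
move=> gT gt fl A Al.
have H : \forall y \near g t, T' y -> A (f y) := fl A Al.
have H' : \forall s \near t, T s -> T' (g s) -> A (f (g s)) := gt _ H.
apply: (filterS (F := nbhs t)) H' => s Hs Ts.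
by apply: Hs => //; apply: gT.
Qed.

(** The Caratheodory slopes multiply: [f (g s) - f (g t)] is [g s - g t] times [phi (g s)], and
    [g s - g t] is [s - t] times [psi s]. *)
Lemma is_deriv_in_comp V T T' (g : R -> R) (f : R -> V) t k l :
  (forall s, T s -> T' (g s)) -> T t -> is_deriv_in T g t k ->
  is_deriv_in T' f (g t) l -> is_deriv_in T (f \o g) t (k *: l).
Proof.
move=> gT Tt gk /is_deriv_inP[phi [phil phit fE]].
have gc := is_deriv_in_continuous gk.
move: gk => /is_deriv_inP[psi [psik psit gE]].
apply/is_deriv_inP; exists (fun s => psi s *: phi (g s)); split.
- apply: cvgZ => //; exact: within_cvg_comp phil.
- by rewrite psit phit.
- move=> s Ts; rewrite /= fE; last exact: gT.
  by rewrite scalerA (gE s Ts) [g t + _]addrC addrK.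
Qed.

Lemma is_deriv_inD V T (f g : R -> V) t k l :
  is_deriv_in T f t k -> is_deriv_in T g t l ->
  is_deriv_in T (fun s => f s + g s) t (k + l).
Proof.
move=> fk gl; rewrite /is_deriv_in.
under eq_fun => s do rewrite /diff_quot opprD addrACA scalerDr.
exact: cvgD.
Qed.

Lemma is_deriv_inZ V T (a : R -> R) (f : R -> V) t k l :
  is_deriv_in T a t k -> is_deriv_in T f t l ->
  is_deriv_in T (fun s => a s *: f s) t (k *: f t + a t *: l).
Proof.
move=> /[dup] /is_deriv_in_continuous ac.
move=> /is_deriv_inP[phi [phik phit aE]] /is_deriv_inP[psi [psil psit fE]].
(* This slope comes from inserting the mixed term [a s *: f t] into the increment of the product. *)
apply/is_deriv_inP; exists (fun s => phi s *: f t + a s *: psi s); split.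
- by apply: cvgD; apply: cvgZ => //; apply: cvg_cst.
- by rewrite phit psit.
- move=> s Ts; rewrite fE// scalerDr {1}(aE s Ts) scalerDl -addrA.
  congr (_ + _); rewrite scalerDr !scalerA -[(s - t) *: phi s]/((s - t) * phi s).
  by rewrite [a s * _]mulrC.
Qed.

(** Serves to differentiate the velocity of the reparameterized curve through its chain-rule
    formula, which is known on [T] only. *)
Lemma is_deriv_in_congr V T (f g : R -> V) t l : T t ->
  (forall s, T s -> f s = g s) -> is_deriv_in T f t l -> is_deriv_in T g t l.
Proof.
move=> Tt fg /is_deriv_inP[phi [phil phit fE]]; apply/is_deriv_inP.
by exists phi; split => // s Ts; rewrite -!fg//; apply: fE.
Qed.

Lemma is_deriv_in_ln T (x : R) : 0 < x -> is_deriv_in T (@ln R) x x^-1.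
Proof.
move=> x0; apply: cvg_within_filter.
have [dln <-] := is_derive1_ln x0.
(* The derivative of [ln] at hand is a limit in the increment tending to 0; substituting [s - x] for
   the increment turns it into a limit of [diff_quot]. *)
have H : (s - x) @[s --> x^'] --> (0 : R)^'.
  move=> A HA.
  have c : (s - x) @[s --> x] --> x - x.
    by apply: cvgB; [exact: cvg_id|exact: cvg_cst].
  rewrite subrr in c.
  have H : \forall s \near x, s - x != 0 -> A (s - x) := c _ HA.
  apply: (filterS (F := nbhs x)) H => s Hs sNx; apply: Hs.
  by rewrite subr_eq0.
have := cvg_comp _ _ H dln; apply: cvg_trans; apply: near_eq_cvg; near=> s.
by rewrite /diff_quot /= [_ *: 1]mulr1 subrK.
Unshelve. all: by end_near. Qed.

(** * Continuous differentiability on a set *)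

Lemma C1_onI V T (f f' : R -> V) :
  (forall t, T t -> ProperFilter (within T t^')) ->
  (forall t, T t -> is_deriv_in T f t (f' t)) -> {within T, continuous f'} ->
  C1_on T f.
Proof.
move=> PT ff' cf'; have H t : T t -> derivable_in T f t /\ deriv_in T f t = f' t.
  by move=> Tt; apply: is_deriv_in_deriv; [exact: PT|exact: ff'].
split=> [t /H[]//|]; apply/within_continuousP => t Tt.
rewrite (H t Tt).2; move/within_continuousP : cf' => /(_ t Tt).
apply: cvg_trans; apply: near_eq_cvg; apply: (filterE (F := nbhs t)) => s Ts /=.
by rewrite (H s Ts).2.
Qed.

Lemma C1_on_comp V T T' (g : R -> R) (f : R -> V) :
  (forall t, T t -> ProperFilter (within T t^')) ->
  (forall s, T s -> T' (g s)) -> C1_on T g -> C1_on T' f -> C1_on T (f \o g).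
Proof.
move=> PT gT [dg /within_continuousP cg] [df /within_continuousP cf].
apply: (C1_onI (f' := fun t => deriv_in T g t *: deriv_in T' f (g t))) => //.
  move=> t Tt; apply: (is_deriv_in_comp gT Tt); apply: derivable_in_is_deriv.
    exact: dg.
  by apply: df; apply: gT.
apply/within_continuousP => t Tt; apply: cvgZ; first exact: cg.
apply: (within_cvg_comp (T' := T')) => //; last by apply: cf; apply: gT.
exact: is_deriv_in_continuous (derivable_in_is_deriv (dg t Tt)).
Qed.

Lemma C1_onD V T (f g : R -> V) :
  (forall t, T t -> ProperFilter (within T t^')) ->
  C1_on T f -> C1_on T g -> C1_on T (fun t => f t + g t).
Proof.
move=> PT [df /within_continuousP cf] [dg /within_continuousP cg].
apply: (C1_onI (f' := fun t => deriv_in T f t + deriv_in T g t)) => //.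
  move=> t Tt; apply: is_deriv_inD; apply: derivable_in_is_deriv; [exact: df|exact: dg].
by apply/within_continuousP => t Tt; apply: cvgD; [exact: cf|exact: cg].
Qed.

Lemma C1_on_ln : C1_on [set x : R | 0 < x] (@ln R).
Proof.
apply: (C1_onI (f' := GRing.inv)).
- move=> t t0; apply: within_dnbhs_proper => //.
    by move=> x y /= x0 _ z /andP[xz _]; apply: lt_le_trans xz.
  by exists 1, 2; split => /=; lra.
- by move=> t; apply: is_deriv_in_ln.
- apply/within_continuousP => t /= t0.
  by apply: cvgV; [rewrite gt_eqF|exact: cvg_within].
Qed.

End DerivIn.

(** * Change of time in the Euler-Lagrange equation *)

Theorem theorem2p2 (R : realType) (d : nat)
  (f h : 'cV[R]_d -> R)
  (f_C1 : C1 f) (f_convex : convex_function setT f)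
  (h_C2 : C2 h) (h_convex : convex_function setT h)
  (h_hessian_inv : forall x, hessian h x \in unitmx)
  (h_ess_smooth : ess_smooth h)
  (T : set R) (T_itv : is_interval T)
  (T_nondegenerate : exists a b, [/\ T a, T b & a < b])
  (tau : R -> R) (tau_C2 : C2_on T tau)
  (tau_incr : forall s t, T s -> T t -> s < t -> tau s < tau t)
  (tau_deriv_gt0 : forall t, T t -> 0 < deriv_in T tau t)
  (alpha beta gamma : R -> R)
  (alpha_C1 : C1_on (tau @` T) alpha)
  (beta_C1 : C1_on (tau @` T) beta)
  (gamma_C1 : C1_on (tau @` T) gamma) :
  let T' := tau @` T in
  let alpha1 := fun t => alpha (tau t) + ln (deriv_in T tau t) in
  let beta1 := fun t => beta (tau t) in
  let gamma1 := fun t => gamma (tau t) in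
  [/\ C1_on T alpha1 /\ C1_on T beta1 /\ C1_on T gamma1,
      forall X : R -> 'cV[R]_d,
        bregman_EL T' f h alpha beta gamma X ->
        bregman_EL T f h alpha1 beta1 gamma1 (fun t => X (tau t))
    & ideal_scaling T' alpha beta gamma <->
      ideal_scaling T alpha1 beta1 gamma1].
Proof.
move=> T' alpha1 beta1 gamma1.
have PT t : T t -> ProperFilter (within T t^') by exact: within_dnbhs_proper.
have tauT s : T s -> T' (tau s) by move=> Ts; exists s.
have [dtau tau'_C1] := tau_C2.
have tau_C1 : C1_on T tau by split=> //; exact: derivable_on_continuous tau'_C1.1.
have deriv_comp (V : normedModType R) (F : R -> V) t : T t ->
    derivable_in T' F (tau t) -> is_deriv_in T (F \o tau) t
      (deriv_in T tau t *: deriv_in T' F (tau t)).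
  move=> Tt /derivable_in_is_deriv; apply: is_deriv_in_comp => //.
  by apply: derivable_in_is_deriv; apply: dtau.
have expR_alpha1 t : T t ->
    expR (alpha1 t) = expR (alpha (tau t)) * deriv_in T tau t.
  by move=> Tt; rewrite expRD lnK// posrE tau_deriv_gt0.
have alpha1' t : T t -> deriv_in T alpha1 t =
    deriv_in T tau t * deriv_in T' alpha (tau t)
    + (deriv_in T tau t)^-1 * deriv_in T (deriv_in T tau) t.
  move=> Tt; apply: (is_deriv_in_deriv (PT t Tt) _).2.
  apply: is_deriv_inD.
    by apply: deriv_comp => //; apply: alpha_C1.1; apply: tauT.
  (* The chain rule puts the inner derivative, here the second derivative of [tau], in front. *)
  rewrite [X in is_deriv_in _ _ _ X]mulrC.
  apply: (is_deriv_in_comp (T' := setT) (f := @ln R)) => //.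
    by apply: derivable_in_is_deriv; apply: tau'_C1.1.
  by apply: is_deriv_in_ln; apply: tau_deriv_gt0.
have beta1' t : T t ->
    deriv_in T beta1 t = deriv_in T tau t * deriv_in T' beta (tau t).
  move=> Tt; apply: (is_deriv_in_deriv (PT t Tt) _).2.
  by apply: deriv_comp => //; apply: beta_C1.1; apply: tauT.
have gamma1' t : T t ->
    deriv_in T gamma1 t = deriv_in T tau t * deriv_in T' gamma (tau t).
  move=> Tt; apply: (is_deriv_in_deriv (PT t Tt) _).2.
  by apply: deriv_comp => //; apply: gamma_C1.1; apply: tauT.
split.
- split; last first.
    split; first exact: (C1_on_comp PT tauT tau_C1 beta_C1).
    exact: (C1_on_comp PT tauT tau_C1 gamma_C1).
  apply: (C1_onD PT); first exact: (C1_on_comp PT tauT tau_C1 alpha_C1).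
  exact: (C1_on_comp PT tau_deriv_gt0 tau'_C1 C1_on_ln).
- move=> X [dX dX' EL].
  have Y' t : T t -> is_deriv_in T (fun s => X (tau s)) t
      (deriv_in T tau t *: deriv_in T' X (tau t)).
    by move=> Tt; apply: deriv_comp => //; apply: dX; apply: tauT.
  have Y'E t : T t -> deriv_in T (fun s => X (tau s)) t =
      deriv_in T tau t *: deriv_in T' X (tau t).
    by move=> Tt; apply: (is_deriv_in_deriv (PT t Tt) (Y' t Tt)).2.
  (* Product rule on the formula for the velocity, then the chain rule for [deriv_in T' X]. *)
  have Y'' t : T t -> is_deriv_in T (deriv_in T (fun s => X (tau s))) t
      (deriv_in T (deriv_in T tau) t *: deriv_in T' X (tau t)
       + deriv_in T tau t *: (deriv_in T tau t *:
           deriv_in T' (deriv_in T' X) (tau t))).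
    move=> Tt; apply: (is_deriv_in_congr
      (f := fun s => deriv_in T tau s *: (deriv_in T' X \o tau) s)) => //.
      by move=> s Ts; rewrite Y'E.
    apply: is_deriv_inZ; first by apply: derivable_in_is_deriv; apply: tau'_C1.1.
    by apply: deriv_comp => //; apply: dX'; apply: tauT.
  split=> [t Tt|t Tt|t Tt].
  + exact: (is_deriv_in_deriv (PT t Tt) (Y' t Tt)).1.
  + exact: (is_deriv_in_deriv (PT t Tt) (Y'' t Tt)).1.
  have := EL (tau t) (tauT t Tt); cbv zeta.
  have t0 : deriv_in T tau t != 0 by rewrite gt_eqF// tau_deriv_gt0.
  rewrite (is_deriv_in_deriv (PT t Tt) (Y'' t Tt)).2 Y'E//.
  rewrite alpha1'// gamma1'// [expR (2 * alpha1 t + _)]expRD.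
  rewrite [expR (2 * alpha1 t)]expRM_natl [expR (- alpha1 t)]expRN.
  rewrite !(expR_alpha1 t Tt) /beta1.
  (* The factors [deriv_in T tau t] cancel, so both equations evaluate [hessian h] and [gradient h]
     at the same point [Z], and the vectors [u] and [w] below are common to both. *)
  have -> : (expR (alpha (tau t)) * deriv_in T tau t)^-1 *:
      (deriv_in T tau t *: deriv_in T' X (tau t)) =
      expR (- alpha (tau t)) *: deriv_in T' X (tau t).
    by rewrite scalerA invfM mulfVK// expRN.
  rewrite expRD expRM_natl.
  set Z := X (tau t) + _; set u := invmx _ *m gradient f _.
  set w := invmx _ *m (_ - _).
  move: t0; move: (deriv_in T tau t) => k k0.
  (* With [u] and [w] opaque, what remains is an entrywise identity between the new expression and
     [k ^+ 2] times the old one; [field] uses [k0] to clear the [k^-1] coming from the derivative of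
     [ln]. *)
  move=> /(congr1 (fun v => k ^+ 2 *: v)) /= EL0.
  rewrite scaler0 in EL0; rewrite -[RHS]EL0; apply/matrixP => i j.
  by rewrite !mxE; field.
- split=> H t.
    move=> Tt; have [le_beta eq_gamma] := H _ (tauT t Tt).
    rewrite beta1'// gamma1'// expR_alpha1// eq_gamma.
    rewrite [expR _ * _]mulrC; split => //.
    by rewrite ler_pM2l// tau_deriv_gt0.
  (* Every point of [T'] is some [tau s], where the positive factor [deriv_in T tau s] can be
     cancelled from both conditions. *)
  move=> [s Ts <-]; have := H s Ts.
  rewrite beta1'// gamma1'// expR_alpha1// [expR _ * _]mulrC.
  rewrite ler_pM2l ?tau_deriv_gt0// => -[le_beta /mulfI eq_gamma].
  by split => //; apply: eq_gamma; rewrite gt_eqF// tau_deriv_gt0.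
Qed.
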